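(* For any $k\ge 2$ there exists a graph in $k_{\mathrm{DIR}}\text{-CONV}$ which is not a SEG graph.
   Context: All graphs are finite. A polygon is a closed convex polygon in $\mathbb{R}^2$. For a finite collection of sets, its intersection graph has one vertex for each member of the collection, and two distinct vertices are adjacent iff the corresponding sets have nonempty intersection. SEG is the class of intersection graphs of finite collections of straight-line segments in the plane. For a set $L$ of $k$ distinct lines through the origin in $\mathbb{R}^2$, $\mathcal{P}(L)$ is the family of all polygons each of whose sides is parallel to some line of $L$; $k_{\mathrm{DIR}(L)}\text{-CONV}$ is the class of intersection graphs of finite collections of polygons from $\mathcal{P}(L)$, and $k_{\mathrm{DIR}}\text{-CONV}$ is the union of $k_{\mathrm{DIR}(L)}\text{-CONV}$ over all sets $L$ of $k$ distinct lines through the origin. *)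

(* Defs.v *)
From HB Require Import structures.
From mathcomp Require Import all_boot all_order all_algebra finmap.
From mathcomp Require Import all_classical all_reals all_analysis.

Set Implicit Arguments.
Unset Strict Implicit.
Unset Printing Implicit Defensive.

Import Order.TTheory GRing.Theory Num.Theory numFieldNormedType.Exports.

Local Open Scope classical_set_scope.
Local Open Scope ring_scope.

Record sgraph := SGraph {
  vertex :> finType;
  adj : rel vertex;
  adj_sym : symmetric adj;
  adj_irrefl : irreflexive adj }.

Section Plane.
Variable R : realType.

Local Notation plane := 'rV[R]_2.

(* The collection is a family indexed by the vertices: several vertices may be
   represented by the same set. *)
Definition intersection_graphs (C : set (set plane)) (G : sgraph) : Prop :=
  exists2 f : G -> set plane,
    (forall v, C (f v)) &
    (forall u v, u != v -> (adj u v <-> f u `&` f v !=set0)).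

Definition segment (a b : plane) : set plane :=
  [set (1 - t) *: a + t *: b | t in `[0, 1]].

Definition is_segment (S : set plane) :=
  exists a b : plane, a != b /\ S = segment a b.

Definition SEG : sgraph -> Prop := intersection_graphs is_segment.

Definition convex_hull (A : set plane) : set plane :=
  smallest (@convex_set R plane) A.

(* The interior condition excludes points and segments. *)
Definition is_polygon (P : set plane) :=
  (exists s : seq plane, P = convex_hull [set` s]) /\ P° !=set0.

Definition dot (n x : plane) : R := (n *m x^T) 0 0.

(* A side is a one-dimensional face, cut out by a supporting line. *)
Definition is_side (P : set plane) (a b : plane) :=
  a != b /\
  exists n : plane, exists c : R,
    [/\ n != 0, P `<=` [set x | dot n x <= c] &
        P `&` [set x | dot n x = c] = segment a b].

Definition lines_through_origin (L : {fset {vspace plane}}) :=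
  forall l, l \in L -> \dim l = 1%N.

Definition polygons_along (L : {fset {vspace plane}}) : set (set plane) :=
  [set P | is_polygon P /\
    forall a b, is_side P a b -> exists2 l, l \in L & b - a \in l].

Definition kDIR_L_CONV (L : {fset {vspace plane}}) : sgraph -> Prop :=
  intersection_graphs (polygons_along L).

Definition kDIR_CONV (k : nat) (G : sgraph) : Prop :=
  exists L : {fset {vspace plane}},
    [/\ lines_through_origin L, #|` L| = k & kDIR_L_CONV L G].

End Plane.

(* Main.v *)
(* The graph consists of the horizontal and vertical bars of a large N x N grid,
   the N^2 cells where two bars cross, and a square meeting everything; it is
   represented by axis-parallel rectangles.

   In a representation by segments everything meets the line of the square's
   segment; choose a foot there for each vertex. If three pairwise disjoint
   adjacent pairs (u_i, v_i), with no adjacency between different pairs, had feet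
   in the order u_0, u_1, u_2, v_0, v_1, v_2, two of the pairs would meet on the
   same side of the line, and their chords would cross, which is impossible.

   A Ramsey argument on the matrix of the feet of the cells gives, for N large,
   seven rows that occupy successive intervals of the line on five common
   columns (or the same with rows and columns exchanged). The five transversal
   bars are adjacent to cells in all seven intervals; three of them have their
   feet on the same side of the middle interval, and with cells of the three
   intervals on the other side they form the forbidden pattern. *)

Require Import Defs.
From mathcomp Require Import all_boot all_order all_algebra finmap.
From mathcomp Require Import all_classical all_reals all_analysis.
From mathcomp Require Import ring lra zify.

Set Implicit Arguments.
Unset Strict Implicit.
Unset Printing Implicit Defensive.

Import Order.TTheory GRing.Theory Num.Theory numFieldNormedType.Exports.

Local Open Scope ring_scope.

(** * A Ramsey-type lemma for matrices over a total order *)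

Lemma pigeonhole_set (T S : finType) (f : T -> S) (A : {set T}) (B : {set S})
    (n : nat) :
  {in A, forall x, f x \in B} -> (#|B| * n < #|A|)%N ->
  exists2 s, s \in B & (n < #|[set x in A | f x == s]|)%N.
Proof.
move=> fAB h; apply/exists_inP; move: h; apply: contraTT => /exists_inPn nex.
rewrite -leqNgt -sum1_card (partition_big f (mem B)) //= -sum_nat_const.
by apply: leq_sum => s /nex; rewrite -leqNgt sum1dep_card.
Qed.

Lemma subset_of_card (T : finType) (A : {set T}) n :
  (n <= #|A|)%N -> exists2 B : {set T}, B \subset A & #|B| = n.
Proof.
move=> nA; exists [set x in take n (enum A)].
  by apply/fintype.subsetP => x; rewrite inE => /mem_take; rewrite mem_enum.
rewrite cardsE (card_uniqP _) ?take_uniq ?enum_uniq // size_take -cardE.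
by case: ltngtP nA.
Qed.

Section SeparatedSubmatrix.
Variables (d : Order.disp_t) (T : orderType d).
Local Open Scope order_scope.

Definition rows_below (I J : finType) (x : I -> J -> T) (C : {set J}) : rel I :=
  fun i i' => [forall j in C, forall j' in C, x i j <= x i' j'].

Lemma rows_belowP (I J : finType) (x : I -> J -> T) (C : {set J}) i i' :
  reflect {in C &, forall j j', x i j <= x i' j'} (rows_below x C i i').
Proof.
apply: (iffP forall_inP) => [h j j' jC j'C|h j jC].
  by have /forall_inP := h j jC; apply.
by apply/forall_inP => j' j'C; apply: h.
Qed.

(** The order of the list [rs] is that of the successive intervals. A row may recur in [rs]: the
    disjointness used later concerns cells in different columns. *)
Definition separated_rows s k (I J : finType) (x : I -> J -> T)
    (A : {set I}) (B : {set J}) :=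
  exists (rs : seq I) (C : {set J}),
    [/\ size rs = k, {subset rs <= A}, C \subset B, (s <= #|C|)%N
      & pairwise (rows_below x C) rs].

Lemma separated_rowsS s k (I J : finType) (x : I -> J -> T)
    (A A' : {set I}) (B B' : {set J}) :
  A' \subset A -> B' \subset B ->
  separated_rows s k x A' B' -> separated_rows s k x A B.
Proof.
move=> /fintype.subsetP sA sB [rs [C [sz rsA CB sC pw]]]; exists rs, C; split => //.
- by move=> i /rsA/sA.
- exact: fintype.subset_trans sB.
Qed.

(* The row with the smallest maximum [p] is below [p]; the other rows are
   sorted by the set of columns where they reach [p], which is nonempty. *)
Lemma separated_submatrix (s k l : nat) : exists M m : nat,
  forall (I J : finType) (x : I -> J -> T) (A : {set I}) (B : {set J}),
    (M <= #|A|)%N -> (m <= #|B|)%N ->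
    separated_rows s k x A B \/ separated_rows s l (fun j i => x i j) B A.
Proof.
elim: k l => [|k IHk] l.
  exists 0%N, s => I J x A B _ sB; left; exists [::], B; split => //.
elim: l => [|l [M2 [m2 IHl]]].
  exists s, 0%N => I J x A B sA _; right; exists [::], A; split => //.
have [M1 [m1 {}IHk]] := IHk l.+1.
(* With [m] columns, either [C] has at least [m1] of them or its complement has at least [m2]. In
   the bound on the rows, [2 ^ m] counts the candidates for [C]; one successor pays for removing
   [i1], the other for the strict inequality in the pigeonhole. *)
pose m := (m1 + m2).*2.+1.
exists (2 ^ m * (M1 + M2)).+2, m => I J x A B0 MA mB0.
have [B sBB0 cB] := subset_of_card mB0.
suff: separated_rows s k.+1 x A B \/
    separated_rows s l.+1 (fun j i => x i j) B A.
  by case=> [h|h]; [left|right]; apply: separated_rowsS h.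
have [i0 i0A] : exists i, i \in A.
  by apply/set0Pn; rewrite -card_gt0; case: #|A| MA.
have [j0 j0B] : exists j, j \in B.
  by apply/set0Pn; rewrite -card_gt0 cB.
pose top i := [arg max_(j > j0 in B) x i j].
have topP i : top i \in B /\ {in B, forall j, x i j <= x i (top i)}.
  by rewrite /top; case: arg_maxP.
pose i1 := [arg min_(i < i0 in A) x i (top i)].
have [i1A i1P] : i1 \in A /\ {in A, forall i, x i1 (top i1) <= x i (top i)}.
  by rewrite /i1; case: arg_minP.
pose p := x i1 (top i1).
pose c i := [set j in B | p <= x i j].
have [||C] := @pigeonhole_set _ _ c (A :\ i1) (powerset B) (M1 + M2).
- by move=> i _; rewrite powersetE; apply/fintype.subsetP => j; rewrite inE => /andP[].
- by rewrite card_powerset cB; move: MA; rewrite (cardsD1 i1) i1A add1n ltnS.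
rewrite powersetE => CB; set A' := [set i in _ | _] => A'M.
have A'A : A' \subset A.
  by apply/fintype.subsetP => i; rewrite !inE => /andP[/andP[]].
have inC i j : i \in A' -> (j \in C) = (j \in B) && (p <= x i j).
  by rewrite inE => /andP[_ /eqP <-]; rewrite inE.
have [i iA'] : exists i, i \in A'.
  by apply/set0Pn; rewrite -card_gt0; case: #|A'| A'M.
have topC : top i \in C.
  by rewrite (inC i) // (topP i).1 i1P // (fintype.subsetP A'A).
(* On [C] the rows of [A'] are above [p], so [i1] can be put in front of them. *)
have [m1C|Cm1] := leqP m1 #|C|.
  have [||[rs [D [sz rsA' DC sD pw]]]|h] := IHk _ _ x A' C => //.
  - by rewrite (leq_trans _ (ltnW A'M)) ?leq_addr.
  - left; exists (i1 :: rs), D; split => //=.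
    + by rewrite sz.
    + by move=> i'; rewrite inE => /predU1P[->//|/rsA'/(fintype.subsetP A'A)].
    + exact: fintype.subset_trans CB.
    + rewrite pw andbT; apply/allP => i' i'rs; apply/rows_belowP => j j' jD j'D.
      apply: (@le_trans _ _ p).
        by apply: (topP i1).2; rewrite (fintype.subsetP CB) // (fintype.subsetP DC).
      by have := fintype.subsetP DC _ j'D; rewrite (inC i') ?rsA' // => /andP[].
  - by right; apply: separated_rowsS h.
(* Outside [C] the rows of [A'] are below [p], while the column [top i], being in [C], is above [p]
   on all of them and can be put last. *)
have [||h|[cs [D [sz csB DA' sD pw]]]] := IHl _ _ x A' (B :\: C).
- by rewrite (leq_trans _ (ltnW A'M)) ?leq_addl.
- have := cardsID C B; rewrite cB (finset.setIidPr CB) /m -addnn.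
  move: Cm1; clear; move: #|C| #|_ :\: _| => a b ab e.
  rewrite -(leq_add2l a) e; apply: leq_trans (_ : m1 + m2 <= _)%N.
    by rewrite leq_add2r ltnW.
  by rewrite -addSn leq_addl.
- by left; apply: separated_rowsS h => //; apply: finset.subsetDl.
right; exists (rcons cs (top i)), D; split => //.
- by rewrite size_rcons sz.
- move=> j; rewrite mem_rcons inE => /predU1P[->|]; first exact: (topP i).1.
  by move/csB; rewrite inE => /andP[].
- exact: fintype.subset_trans A'A.
rewrite pairwise_rcons pw andbT; apply/allP => j jcs.
apply/rows_belowP => i' i'' /(fintype.subsetP DA') i'A' /(fintype.subsetP DA') i''A'.
have := topC; rewrite (inC i'') // => /andP[_]; apply: le_trans.
have := csB _ jcs; rewrite inE (inC i') // => /andP[+ jB]; rewrite jB /=.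
by rewrite -ltNge => /ltW.
Qed.

End SeparatedSubmatrix.

Local Open Scope classical_set_scope.

(** * Convex sets with feet on a common line *)

Section Chords.
Variable R : realType.
Implicit Types (A B : set 'rV[R]_2) (p q : 'rV[R]_2).

Lemma convex_setP A : @convex_set R 'rV[R]_2 A <->
  forall t a b, 0 <= t <= 1 -> A a -> A b -> A ((1 - t) *: a + t *: b).
Proof.
split=> [cA t a b /andP[t0 t1] Aa Ab|cA a b t /set_mem Aa /set_mem Ab].
  have := cA b a (Itv01 t0 t1) (mem_set Ab) (mem_set Aa).
  by rewrite inE addrC.
by rewrite inE /conv /= addrC; apply: (cA t%:num) => //; apply/andP; split.
Qed.

Lemma segment_convex a b : @convex_set R 'rV[R]_2 (segment a b).
Proof.
apply/convex_setP => t _ _ /andP[t0 t1] [u + <-] [v + <-]; rewrite /= !in_itv /=.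
move=> /andP[u0 u1] /andP[v0 v1]; exists ((1 - t) * u + t * v).
  by rewrite /= in_itv /=; apply/andP; split; nra.
by rewrite !scalerDr !scalerA addrACA -!scalerDl; congr (_ *: _ + _ *: _); ring.
Qed.

Lemma segment_start (a b : 'rV[R]_2) : segment a b a.
Proof.
exists 0; first by rewrite /= in_itv /= lexx ler01.
by rewrite subr0 scale1r scale0r addr0.
Qed.

Lemma segment_end (a b : 'rV[R]_2) : segment a b b.
Proof.
exists 1; first by rewrite /= in_itv /= lexx ler01.
by rewrite subrr scale1r scale0r add0r.
Qed.

Lemma dot_conv p t a b :
  dot p ((1 - t) *: a + t *: b) = (1 - t) * dot p a + t * dot p b.
Proof. by rewrite /dot linearD !linearZ /= mulmxDr -!scalemxAr !mxE. Qed.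

Lemma dotNl p a : dot (- p) a = - dot p a.
Proof. by rewrite /dot mulNmx mxE. Qed.

Lemma dotE p a : dot p a = p 0 0 * a 0 0 + p 0 1 * a 0 1.
Proof.
rewrite /dot mxE big_ord_recr big_ord1 /= !mxE.
by congr (p 0 _ * a 0 _ + p 0 _ * a 0 _); apply: val_inj.
Qed.

(** The two linear forms serve as coordinates: [p] along the line of the feet, [q] across it. *)
Definition separating p q :=
  forall a b, dot p a = dot p b -> dot q a = dot q b -> a = b.

(** Run through both chords with the same parameter: their [q]-heights stay equal and the difference
    of their [p]-values is affine with a change of sign, so the chords meet at its zero. *)
Lemma swapped_meet p q A B a0 a1 b0 b1 :
  separating p q -> @convex_set R 'rV[R]_2 A -> @convex_set R 'rV[R]_2 B ->
  A a0 -> A a1 -> B b0 -> B b1 ->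
  dot q a0 = dot q b0 -> dot q a1 = dot q b1 ->
  dot p a0 <= dot p b0 -> dot p b1 <= dot p a1 ->
  A `&` B !=set0.
Proof.
move=> inj /convex_setP cA /convex_setP cB Aa0 Aa1 Bb0 Bb1 eq0 eq1 le0 le1.
have [e0|ne0] := eqVneq (dot p a0) (dot p b0).
  by exists a0; split=> //; rewrite (inj _ _ e0 eq0).
pose D := (dot p b0 - dot p a0) + (dot p a1 - dot p b1).
have lt0 : dot p a0 < dot p b0 by rewrite lt_neqAle ne0.
have D0 : 0 < D by rewrite /D; lra.
pose t := (dot p b0 - dot p a0) / D.
have t01 : 0 <= t <= 1.
  rewrite /t divr_ge0 ?(ltW D0) ?subr_ge0 //= ler_pdivrMr // mul1r /D.
  by rewrite lerDl subr_ge0.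
exists ((1 - t) *: a0 + t *: a1); split; first exact: cA.
suff -> : (1 - t) *: a0 + t *: a1 = (1 - t) *: b0 + t *: b1 by exact: cB.
apply: inj; rewrite !dot_conv ?eq0 ?eq1 //.
have tD : t * D = dot p b0 - dot p a0 by rewrite /t divfK // gt_eqF.
by rewrite /D in tD; lra.
Qed.

(* Compare the two chords at the height of the lower of their apexes [w], [w']. *)
Lemma crossing_chords p q c (A A' B B' : set 'rV[R]_2) a a' b b' w w' :
  separating p q ->
  @convex_set R 'rV[R]_2 A -> @convex_set R 'rV[R]_2 A' ->
  @convex_set R 'rV[R]_2 B -> @convex_set R 'rV[R]_2 B' ->
  A a -> A' a' -> B b -> B' b' -> (A `&` A') w -> (B `&` B') w' ->
  dot q a = c -> dot q a' = c -> dot q b = c -> dot q b' = c ->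
  c <= dot q w -> c <= dot q w' ->
  dot p a <= dot p b -> dot p b <= dot p a' -> dot p a' <= dot p b' ->
  [\/ A `&` B !=set0, B `&` A' !=set0 | A' `&` B' !=set0].
Proof.
move=> inj cA cA' cB cB' Aa A'a' Bb B'b' [Aw A'w] [Bw' B'w'].
move=> qa qa' qb qb' cw cw' ab ba' a'b'.
(* Walk from the foot [x] towards [y]; if [y] is on the line too, then [z = c] and the foot itself
   serves. *)
have at_height (C : set 'rV[R]_2) x y z :
    @convex_set R 'rV[R]_2 C -> C x -> C y ->
    dot q x = c -> c <= z <= dot q y -> exists2 v, C v & dot q v = z.
  move=> /convex_setP cC Cx Cy qx /andP[cz zy].
  have [yc|yc] := eqVneq (dot q y) c.
    by exists x => //; rewrite qx; lra.
  have yc0 : 0 < dot q y - c by rewrite subr_gt0 lt_neqAle eq_sym yc; lra.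
  exists ((1 - (z - c) / (dot q y - c)) *: x + ((z - c) / (dot q y - c)) *: y).
    by apply: cC => //; rewrite divr_ge0 /= ?ler_pdivrMr //; lra.
  by rewrite dot_conv qx; field; rewrite gt_eqF.
have [ww'|/ltW w'w] := leP (dot q w) (dot q w').
  have [v Bv qv] := at_height B b w' (dot q w) cB Bb Bw' qb ltac:(lra).
  (* At the height of the apex [w], shared by [A] and [A'], the set [B] has changed sides either
     with [A] or with [A']. *)
  have [vw|/ltW wv] := leP (dot p v) (dot p w).
    by apply: Or31; apply: (swapped_meet inj cA cB Aa Aw Bb Bv); lra.
  by apply: Or32; apply: (swapped_meet inj cB cA' Bb Bv A'a' A'w); lra.
have [v A'v qv] := at_height A' a' w (dot q w') cA' A'a' A'w qa' ltac:(lra).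
have [vw|/ltW wv] := leP (dot p v) (dot p w').
  by apply: Or32; apply: (swapped_meet inj cB cA' Bb Bw' A'a' A'v); lra.
by apply: Or33; apply: (swapped_meet inj cA' cB' A'a' A'v B'b' B'w'); lra.
Qed.

Lemma sorted_triple (J : finType) (f : J -> R) (D : {set J}) : (2 < #|D|)%N ->
  exists h : nat -> J, (forall i, (i < 3)%N -> h i \in D) /\
    forall i j, (i < j < 3)%N -> h i != h j /\ f (h i) <= f (h j).
Proof.
rewrite cardE; set r := relpre f <=%O; pose s := sort r (enum D).
rewrite -(size_sort r) -/s => s3.
have [j0 _] : exists j0, j0 \in s.
  by case: s s3 => // j0 s _; exists j0; exact: mem_head.
have ss : pairwise r s.
  rewrite -sorted_pairwise; last by move=> a b d; apply: le_trans.
  by apply: sort_sorted => a b; apply: le_total.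
exists (nth j0 s); split=> [i i3|i j /andP[ij j3]].
  by rewrite -mem_enum -(mem_sort r) mem_nth // (leq_trans i3).
have js : (j < size s)%N by rewrite (leq_trans j3).
have is_ : (i < size s)%N by rewrite (ltn_trans ij).
split; last by move/pairwiseP: ss => /(_ j0 i j is_ js ij).
by rewrite nth_uniq ?sort_uniq ?enum_uniq // neq_ltn ij.
Qed.

Section Family.
Variables (V : Type) (F : V -> set 'rV[R]_2) (foot : V -> 'rV[R]_2).
Variables (p q : 'rV[R]_2) (c : R).
Hypothesis pq : separating p q.
Hypothesis convF : forall v, @convex_set R 'rV[R]_2 (F v).
Hypothesis Ffoot : forall v, F v (foot v).
Hypothesis foot_line : forall v, dot q (foot v) = c.
Local Notation pos v := (dot p (foot v)).
Local Notation disjoint u v := (F u `&` F v = set0).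

(* By pigeonhole two of the chords lie on the same side of the line. *)
Lemma three_crossing_chords (u v : nat -> V) :
  (forall i, (i < 3)%N -> F (u i) `&` F (v i) !=set0) ->
  (forall i j, (i < j < 3)%N -> [/\ disjoint (u i) (u j), disjoint (u j) (v i)
     & disjoint (v i) (v j)]) ->
  (forall i j, (i < j < 3)%N -> [/\ pos (u i) <= pos (u j), pos (u j) <= pos (v i)
     & pos (v i) <= pos (v j)]) ->
  False.
Proof.
move=> meet disj le.
pose above i := exists2 w, (F (u i) `&` F (v i)) w & c <= dot q w.
pose below i := exists2 w, (F (u i) `&` F (v i)) w & dot q w <= c.
have side i : (i < 3)%N -> above i \/ below i.
  move=> /meet[w Fw]; have [cw|/ltW wc] := leP c (dot q w); first by left; exists w.
  by right; exists w.
have aboveN i j : (i < j < 3)%N -> above i -> above j -> False.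
  move=> ij [w Fw cw] [w' Fw' cw'].
  have [d1 d2 d3] := disj i j ij; have [l1 l2 l3] := le i j ij.
  have := crossing_chords pq (@convF _) (@convF _) (@convF _) (@convF _)
    (Ffoot (u i)) (Ffoot (v i)) (Ffoot (u j)) (Ffoot (v j)) Fw Fw' (foot_line _) (foot_line _)
    (foot_line _) (foot_line _) cw cw' l1 l2 l3.
  by rewrite d1 d2 d3 => -[] /set0P/eqP.
have belowN i j : (i < j < 3)%N -> below i -> below j -> False.
  move=> ij [w Fw cw] [w' Fw' cw'].
  have [d1 d2 d3] := disj i j ij; have [l1 l2 l3] := le i j ij.
  (* Replacing [q] by [- q] exchanges the two sides of the line. *)
  have pNq : separating p (- q).
    by move=> a b pab; rewrite !dotNl => /oppr_inj; apply: pq.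
  have nfoot x : dot (- q) (foot x) = - c by rewrite dotNl foot_line.
  have := crossing_chords pNq (@convF _) (@convF _) (@convF _) (@convF _)
    (Ffoot (u i)) (Ffoot (v i)) (Ffoot (u j)) (Ffoot (v j)) Fw Fw' (nfoot _) (nfoot _)
    (nfoot _) (nfoot _).
  rewrite !dotNl !lerN2 d1 d2 d3 => /(_ cw cw' l1 l2 l3).
  by case=> /set0P/eqP.
case: (side 0%N isT) (side 1%N isT) (side 2%N isT) => [s0|s0] [s1|s1] [s2|s2];
  by [apply: (aboveN 0%N 1%N) | apply: (aboveN 0%N 2%N) | apply: (aboveN 1%N 2%N)
     |apply: (belowN 0%N 1%N) | apply: (belowN 0%N 2%N) | apply: (belowN 1%N 2%N)].
Qed.

(* Three of the hubs lie on the same side of a leaf of the middle level; these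
   are matched with leaves of the three levels on the other side. *)
Lemma separated_stars (J : finType) (hub : J -> V) (leaf : nat -> J -> V)
    (D : {set J}) :
  (5 <= #|D|)%N ->
  (forall r j, F (hub j) `&` F (leaf r j) !=set0) ->
  (forall j j', j != j' -> disjoint (hub j) (hub j')) ->
  (forall r j j', j != j' -> disjoint (hub j) (leaf r j')) ->
  (forall r r' j j', j != j' -> disjoint (leaf r j) (leaf r' j')) ->
  (forall r r', (r < r' < 7)%N -> {in D &, forall j j',
     pos (leaf r j) <= pos (leaf r' j')}) ->
  False.
Proof.
move=> D5 meet dhh dhl dll le.
have [j0 j0D] : exists j, j \in D.
  by apply/set0Pn; rewrite -card_gt0 (leq_trans _ D5).
(* Level 3 is the middle one of the levels 0 to 6. *)
pose z := pos (leaf 3 j0).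
pose D1 := [set j in D | pos (hub j) <= z].
have : (2 < #|D1|)%N || (2 < #|D :\: D1|)%N.
  rewrite -(cardsID D1 D) in D5.
  have /subset_leq_card : D :&: D1 \subset D1 by exact: subsetIr.
  by move: D5; move: #|_| #|_| #|_| => *; lia.
case/orP => /(sorted_triple (fun j => pos (hub j)))[h [hD hP]].
  have hD' i : (i < 3)%N -> h i \in D /\ pos (hub (h i)) <= z.
    by move=> /hD; rewrite inE => /andP.
  (* These hubs precede the levels 4, 5, 6 and act as the [u i]. In the other case the leaves of
     levels 0, 1, 2 act as the [u i], and the hubs as the [v i]. *)
  apply: (@three_crossing_chords (hub \o h) (fun i => leaf (i + 4) (h i))) => /=.
  - by move=> i _; apply: meet.
  - move=> i j /hP[ij _]; split; [exact: dhh| |exact: dll].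
    by apply: dhl; rewrite eq_sym.
  - move=> i j ij; have /andP[ij' j3] := ij; have i3 := ltn_trans ij' j3.
    have [hiD _] := hD' _ i3; have [hjD hjz] := hD' _ j3.
    split; first exact: (hP _ _ ij).2.
      by apply: le_trans hjz _; apply: le => //; lia.
    by apply: le => //; lia.
have hD' i : (i < 3)%N -> h i \in D /\ z <= pos (hub (h i)).
  by move=> /hD; rewrite !inE => /andP[+ jD]; rewrite jD /= -ltNge => /ltW.
apply: (@three_crossing_chords (fun i => leaf i (h i)) (hub \o h)) => /=.
- by move=> i _; rewrite setIC; apply: meet.
- move=> i j /hP[ij _]; split; [exact: dll| |exact: dhh].
  by rewrite setIC; apply: dhl.
- move=> i j ij; have /andP[ij' j3] := ij; have i3 := ltn_trans ij' j3.
  have [hiD hiz] := hD' _ i3; have [hjD _] := hD' _ j3.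
  split; last exact: (hP _ _ ij).2.
    by apply: le => //; lia.
  by apply: le_trans hiz; apply: le => //; lia.
Qed.
End Family.
End Chords.

(** * Axis-parallel rectangles as polygons with prescribed side directions *)

Section Rectangles.
Variable R : realType.
Implicit Types (a b c d : R) (x y : 'rV[R]_2).

Definition point a b : 'rV[R]_2 := \row_j (if j == 0 then a else b).

Definition rectangle a b c d : set 'rV[R]_2 :=
  [set x | a <= x 0 0 <= b /\ c <= x 0 1 <= d].

Lemma point0 a b : point a b 0 0 = a. Proof. by rewrite mxE. Qed.

Lemma point1 a b : point a b 0 1 = b. Proof. by rewrite mxE. Qed.

Lemma plane_eq x y : x 0 0 = y 0 0 -> x 0 1 = y 0 1 -> x = y.
Proof.
move=> e0 e1; apply/rowP => -[[|[|//]] lt2].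
  by rewrite (_ : Ordinal lt2 = 0) //; apply: val_inj.
by rewrite (_ : Ordinal lt2 = 1) //; apply: val_inj.
Qed.

Lemma rectangle_convex a b c d : @convex_set R 'rV[R]_2 (rectangle a b c d).
Proof.
apply/convex_setP => t x y /andP[t0 t1] [/andP[x1 x2] /andP[x3 x4]].
move=> [/andP[y1 y2] /andP[y3 y4]]; rewrite /rectangle /= !mxE.
by split; apply/andP; split; nra.
Qed.

Lemma barycenter a b (x : R) : a < b -> a <= x <= b ->
  exists2 t, 0 <= t <= 1 & x = (1 - t) * a + t * b.
Proof.
move=> ab /andP[ax xb]; have ba0 : 0 < b - a by rewrite subr_gt0.
exists ((x - a) / (b - a)); last by field; rewrite gt_eqF.
by rewrite divr_ge0 ?ler_pdivrMr //=; lra.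
Qed.

Lemma rectangle_hull a b c d : a < b -> c < d ->
  rectangle a b c d =
  convex_hull [set` [:: point a c; point b c; point a d; point b d]].
Proof.
move=> ab cd; apply/seteqP; split.
  move=> x [/(barycenter ab)[s s01 xs] /(barycenter cd)[t t01 xt]].
  move=> M [/convex_setP cM sM].
  have -> : x = (1 - t) *: ((1 - s) *: point a c + s *: point b c) +
      t *: ((1 - s) *: point a d + s *: point b d).
    apply: plane_eq; rewrite 2!mxE 3!mxE 3!mxE !mxE ?xs ?xt /=; ring.
  by apply: (cM) => //; apply: (cM) => //; apply: sM; rewrite /= !inE eqxx ?orbT.
apply: smallest_sub; first exact: rectangle_convex.
move=> x; rewrite /= !inE => /or4P[] /eqP->;
  by rewrite /rectangle /= point0 point1 !lexx !ltW.
Qed.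

Lemma rectangle_polygon a b c d : a < b -> c < d -> is_polygon (rectangle a b c d).
Proof.
move=> ab cd; split; first by eexists; exact: rectangle_hull.
pose e := Num.min ((b - a) / 2) ((d - c) / 2).
have e0 : 0 < e by rewrite /e lt_min !divr_gt0 ?subr_gt0.
exists (point ((a + b) / 2) ((c + d) / 2)); rewrite /interior /=.
apply/nbhs_ballP; exists e => //= x [_ xe].
have := xe 0 0; have := xe 0 1; rewrite -!ball_normE /= !mxE /=.
have [e1 e2] : e <= (b - a) / 2 /\ e <= (d - c) / 2 by rewrite /e !ge_min !lexx orbT.
rewrite !ltr_norml => /andP[? ?] /andP[? ?].
by split; apply/andP; split; lra.
Qed.

(** If the normal has a nonzero first coordinate, sliding an endpoint horizontally to the edge
    favoured by its sign must not exceed [m], so both endpoints are already on that edge. Otherwise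
    the supporting line is horizontal. *)
Lemma rectangle_side a b c d x y : is_side (rectangle a b c d) x y ->
  x 0 0 = y 0 0 \/ x 0 1 = y 0 1.
Proof.
move=> [_ [n [m [n0 le_m face]]]].
have onface z : segment x y z -> rectangle a b c d z /\ dot n z = m.
  by rewrite -face => -[].
have [[/andP[x1 x2] /andP[x3 x4]] nx] : rectangle a b c d x /\ dot n x = m.
  by apply: onface; exact: segment_start.
have [[/andP[y1 y2] /andP[y3 y4]] ny] : rectangle a b c d y /\ dot n y = m.
  by apply: onface; exact: segment_end.
have rle u v : a <= u <= b -> c <= v <= d -> n 0 0 * u + n 0 1 * v <= m.
  move=> ub vd; have := le_m (point u v); rewrite /= dotE !point0 !point1; apply.
  by rewrite /rectangle /= point0 point1.
rewrite !dotE in nx ny.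
have a1 : a <= b by lra.
have c1 : c <= d by lra.
have [n00|n00] := eqVneq (n 0 0) 0.
  have n01 : n 0 1 != 0.
    by apply: contra_neq n0 => n01; apply: plane_eq; rewrite !mxE.
  right; apply: (mulfI n01); move: nx ny; rewrite n00 !mul0r; lra.
left; move: n00; rewrite neq_lt => /orP[] n00.
  have := rle a (x 0 1); have := rle a (y 0 1).
  by rewrite lexx a1 x3 x4 y3 y4 => /(_ isT isT) ? /(_ isT isT) ?; nra.
have := rle b (x 0 1); have := rle b (y 0 1).
by rewrite lexx a1 x3 x4 y3 y4 => /(_ isT isT) ? /(_ isT isT) ?; nra.
Qed.

Lemma rectangle_meet a b c d a' b' c' d' :
  a <= b -> c <= d -> a' <= b' -> c' <= d' ->
  (rectangle a b c d `&` rectangle a' b' c' d' !=set0 <->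
   (a <= b' /\ a' <= b) /\ (c <= d' /\ c' <= d)).
Proof.
move=> ab cd ab' cd'; split.
  by move=> [x [[/andP[? ?] /andP[? ?]] [/andP[? ?] /andP[? ?]]]]; split; split; lra.
move=> [[? ?] [? ?]]; exists (point (Num.max a a') (Num.max c c')).
by split; split; rewrite ?point0 ?point1 le_max ge_max ?lexx ?orbT /=; apply/andP.
Qed.

(** Index 0 gives the vertical axis and index 1 the horizontal one. All spanning vectors have
    coordinate sum 1, so different ones span different lines. *)
Definition direction (i : nat) : {vspace 'rV[R]_2} :=
  <[point i%:R (1 - i%:R)]>%VS.

Lemma direction_inj : injective direction.
Proof.
move=> i j eij; have : point i%:R (1 - i%:R) \in direction j by rewrite -eij memv_line.
case/vlineP => k /matrixP e; have := e 0 0; have := e 0 1; rewrite !mxE /=.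
move=> e1 e0; have k1 : k = 1 by lra.
by apply/eqP; rewrite -(eqr_nat R) e0 k1 mul1r.
Qed.

Lemma dim_direction i : \dim (direction i) = 1%N.
Proof.
rewrite dim_vline; apply/eqP; rewrite eqb1; apply/eqP => /matrixP e.
by have := e 0 0; have := e 0 1; rewrite !mxE /=; lra.
Qed.

Definition directions (k : nat) : {fset {vspace 'rV[R]_2}} :=
  [fset direction (nat_of_ord i) | i in 'I_k]%fset.

Lemma card_directions k : #|` directions k| = k.
Proof.
rewrite card_imfset /=; last by move=> i j /direction_inj/val_inj.
by rewrite -cardE card_ord.
Qed.

Lemma rectangle_along k a b c d : (2 <= k)%N -> a < b -> c < d ->
  polygons_along (directions k) (rectangle a b c d).
Proof.
move=> k2 ab cd; split; first exact: rectangle_polygon.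
have mem_dir i : (i < k)%N -> direction i \in directions k.
  by move=> ik; apply/imfsetP; exists (Ordinal ik).
move=> x y /rectangle_side[] exy.
  exists (direction 0); first by rewrite mem_dir // ltnW.
  apply/vlineP; exists (y 0 1 - x 0 1).
  by apply: plane_eq; rewrite !mxE /= ?exy; ring.
exists (direction 1); first by rewrite mem_dir.
apply/vlineP; exists (y 0 0 - x 0 0).
by apply: plane_eq; rewrite !mxE /= ?exy; ring.
Qed.

End Rectangles.

(** * The grid graph and its representations *)

Section BarGraph.
Variable N : nat.
Local Notation bar := (option 'I_N).

(** Vertices stand for products of two intervals: [None] is a long interval, the [Some i] are
    disjoint short ones inside it. *)
Definition bar_meet (s t : bar) := [|| s == None, t == None | s == t].

Definition grid_adj (u v : bar * bar) :=
  [&& u != v, bar_meet u.1 v.1 & bar_meet u.2 v.2].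

Lemma bar_meet_sym : symmetric bar_meet.
Proof. by move=> s t; rewrite /bar_meet orbCA [s == t]eq_sym. Qed.

Lemma grid_adj_sym : symmetric grid_adj.
Proof.
by move=> u v; rewrite /grid_adj eq_sym bar_meet_sym [bar_meet u.2 _]bar_meet_sym.
Qed.

Lemma grid_adj_irrefl : irreflexive grid_adj.
Proof. by move=> u; rewrite /grid_adj eqxx. Qed.

(* [(None, None)] is the big square, [(Some i, None)] and [(None, Some j)] are
   the bars across it, and [(Some i, Some j)] is a cell where two bars cross. *)
Definition grid_graph : sgraph := SGraph grid_adj_sym grid_adj_irrefl.

(** Unit gaps keep the closed short intervals apart; the end [2N + 1] leaves the long one
    nondegenerate even for [N = 0]. *)
Definition bar_lo (s : bar) : nat := if s is Some i then i.*2 else 0.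

Definition bar_hi (s : bar) : nat := if s is Some i then i.*2.+1 else N.*2.+1.

Lemma bar_lo_hi s : (bar_lo s < bar_hi s)%N.
Proof. by case: s => /=. Qed.

Lemma bar_meetE s t :
  bar_meet s t = (bar_lo s <= bar_hi t)%N && (bar_lo t <= bar_hi s)%N.
Proof.
case: s t => [i|] [j|] //=; rewrite /bar_meet /=.
- rewrite (inj_eq (@Some_inj _)) -val_eqE /=; lia.
- by have := ltn_ord i; lia.
- by have := ltn_ord j; lia.
Qed.

Lemma grid_graph_kDIR (R : realType) k : (2 <= k)%N -> kDIR_CONV R k grid_graph.
Proof.
move=> k2; exists (directions R k); split; first 2 [exact: card_directions].
  by move=> l /imfsetP[i _ ->]; apply: dim_direction.
exists (fun u : bar * bar => @rectangle R (bar_lo u.1)%:R (bar_hi u.1)%:R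
                                 (bar_lo u.2)%:R (bar_hi u.2)%:R).
  by move=> u; apply: rectangle_along => //; rewrite ltr_nat bar_lo_hi.
move=> u v uv; rewrite /adj /= /grid_adj uv !bar_meetE /=.
apply: iff_trans (iff_sym (rectangle_meet _ _ _ _));
  rewrite ?ler_nat ?(ltnW (bar_lo_hi _)) //.
split; first by case/andP => /andP[-> ->] /andP[-> ->].
by case=> -[-> ->] [-> ->].
Qed.

Lemma grid_graph_segments (R : realType) :
  SEG R grid_graph ->
  exists x : 'I_N -> 'I_N -> R,
    ~ separated_rows 5 7 x [set: _]%SET [set: _]%SET /\
    ~ separated_rows 5 7 (fun j i => x i j) [set: _]%SET [set: _]%SET.
Proof.
move=> [F segF adjF].
have convF v : @convex_set R 'rV[R]_2 (F v).
  by have [a [b [_ ->]]] := segF v; apply: segment_convex.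
pose o : grid_graph := (None, None).
have [a [b [ab Fo]]] := segF o.
have meet_o v : F v `&` F o !=set0.
  have [->|vo] := eqVneq v o.
    by rewrite setIid Fo; exists a; exact: segment_start.
  by apply/(adjF _ _ vo); rewrite /= /grid_adj vo /bar_meet !orbT.
have [foot footF] := choice meet_o.
(* [p] is the direction of the square's segment and [q] is [p] turned by a right angle. *)
pose p := b - a; pose q := point (- p 0 1) (p 0 0).
have dotq x : dot q x = p 0 0 * x 0 1 - p 0 1 * x 0 0.
  by rewrite dotE point0 point1; ring.
have foot_line v : dot q (foot v) = dot q a.
  have [_] := footF v; rewrite Fo => -[t _ <-].
  by rewrite dot_conv !dotq /p !mxE; ring.
have pp : 0 < p 0 0 ^+ 2 + p 0 1 ^+ 2.
  rewrite lt_neqAle eq_sym addr_ge0 ?sqr_ge0 // andbT paddr_eq0 ?sqr_ge0 //.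
  rewrite !sqrf_eq0; apply: contra ab => /andP[/eqP p0 /eqP p1].
  by rewrite eq_sym -subr_eq0; apply/eqP/plane_eq; rewrite ?p0 ?p1 !mxE.
have pq : separating p q.
  move=> x y; rewrite !dotq !dotE => px qx.
  (* The linear system for the coordinates has determinant [pp], the squared length of [p]; these
     multiples of its equations solve it. *)
  have mul r := (congr1 (fun z => r * z) px, congr1 (fun z => r * z) qx).
  have [[pp0 pq0] [pp1 pq1]] := (mul (p 0 0), mul (p 0 1)).
  by apply: plane_eq; apply: (mulfI (lt0r_neq0 pp)); lra.
have disj u v : u != v -> ~~ grid_adj u v -> F u `&` F v = set0.
  by move=> uv; apply: contraNeq => /set0P /(adjF _ _ uv).
have Ffoot v : F v (foot v) by have [] := footF v.
pose far u v := (u != v) && ~~ grid_adj u v.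
(* Hubs and cells are kept abstract so that rows and columns can exchange roles. *)
have no_rows (hub : 'I_N -> grid_graph) (cell : 'I_N -> 'I_N -> grid_graph) :
    (forall i j, grid_adj (hub j) (cell i j)) ->
    (forall i i' j j', j != j' ->
      [&& far (hub j) (hub j'), far (hub j) (cell i j')
        & far (cell i j) (cell i' j')]) ->
    ~ separated_rows 5 7 (fun i j => dot p (foot (cell i j)))
        [set: _]%SET [set: _]%SET.
  move=> adj_cell far_cell [rs [C [sz _ _ C5 /pairwiseP pw]]].
  have [i0 _] : exists i, i \in rs.
    by case: rs sz {pw} => // i *; exists i; apply: mem_head.
  have far_disj u v : far u v -> F u `&` F v = set0 by case/andP; apply: disj.
  (* Beyond the seventh level [nth] returns [i0], a genuine row, so the adjacencies hold for every
     [r]; the order is required only below 7. *)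
  apply: (separated_stars pq convF Ffoot foot_line (hub := hub)
    (leaf := fun r => cell (nth i0 rs r)) C5).
  - by move=> r j; apply/adjF; [case/and3P: (adj_cell (nth i0 rs r) j)|apply: adj_cell].
  - by move=> j j' /(far_cell i0 i0)/and3P[/far_disj].
  - by move=> r j j' /(far_cell (nth i0 rs r) i0)/and3P[_ /far_disj].
  - by move=> r r' j j' /(far_cell (nth i0 rs r) (nth i0 rs r'))/and3P[_ _ /far_disj].
  - move=> r r' /andP[rr' r7].
    have in_rs n : (n <= r')%N -> n \in gtn (size rs).
      by rewrite inE sz => /leq_ltn_trans; apply.
    by have /rows_belowP := pw i0 r r' (in_rs _ (ltnW rr')) (in_rs _ (leqnn _)) rr'.
exists (fun i j => dot p (foot (Some i, Some j))); split.
  (* For separated rows the hubs are the bars indexed by the columns; below, the roles are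
     exchanged. *)
  apply: (no_rows (fun j => (None, Some j)) (fun i j => (Some i, Some j))).
    by move=> i j; rewrite /grid_adj /bar_meet /= eqxx.
  by move=> i i' j j' jj'; rewrite /far /grid_adj /bar_meet !xpair_eqE /=
    !(inj_eq (@Some_inj _)) (negPf jj') !andbF.
apply: (no_rows (fun i => (Some i, None)) (fun j i => (Some i, Some j))).
  by move=> j i; rewrite /grid_adj /bar_meet xpair_eqE /= !eqxx andbF.
by move=> j j' i i' ii'; rewrite /far /grid_adj /bar_meet !xpair_eqE /=
  !(inj_eq (@Some_inj _)) (negPf ii') ?andbF ?orbF ?andbF.
Qed.

End BarGraph.

Theorem theorem2 (R : realType) (k : nat) (hk : (2 <= k)%N) :
  exists G : sgraph, kDIR_CONV R k G /\ ~ SEG R G.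
Proof.
have [M [m sep]] := @separated_submatrix _ R 5 7 7.
exists (grid_graph (maxn M m)); split; first exact: grid_graph_kDIR.
move=> /grid_graph_segments[x [nrows ncols]].
have [||/nrows|/ncols] := sep _ _ x [set: _]%SET [set: _]%SET;
  by rewrite // cardsT card_ord ?leq_maxl ?leq_maxr.
Qed.
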